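(* There exist two measure-preserving actions of the free group on two generators $\mathbb F_2$ on a standard probability space $(X,\mu)$ such that the identity map of $X$ is an $\mathrm L^1$ orbit equivalence between them but they do not share the same $\mathrm L^1$ full group (i.e. their $\mathrm L^1$ full groups are distinct as subgroups of $\mathrm{Aut}(X,\mu)$).
   Context: A standard probability space $(X,\mu)$ is a standard Borel space with a non-atomic Borel probability measure. $\mathrm{Aut}(X,\mu)$ is the group of measure-preserving Borel bijections of $X$ modulo a.e. equality. For a measure-preserving action $\alpha$ of a finitely generated group $\Gamma$ with finite generating set $S$, each orbit carries the Schreier graph metric $d_\alpha$, where $d_\alpha(x,y)$ is the least $n$ such that $y=\alpha(s_n)\cdots\alpha(s_1)x$ with $s_i\in S\cup S^{-1}$. The $\mathrm L^1$ full group of $\alpha$ is the group of all $T\in\mathrm{Aut}(X,\mu)$ such that $T(x)\in\alpha(\Gamma)x$ for a.e. $x$ and $\int_Xd_\alpha(x,T(x))\,d\mu(x)<+\infty$; it does not depend on $S$. The identity map is an $\mathrm L^1$ orbit equivalence between actions $\alpha_1$ of $\Gamma$ and $\alpha_2$ of $\Lambda$ on $(X,\mu)$ if a.e. the two actions have the same orbits and for all $\gamma\in\Gamma$, $\lambda\in\Lambda$ the maps $x\mapsto d_{\alpha_1}(x,\alpha_2(\lambda)x)$ and $x\mapsto d_{\alpha_2}(x,\alpha_1(\gamma)x)$ are integrable. *)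

(* Defs.v *)
From HB Require Import structures.
From mathcomp Require Import all_boot all_order all_algebra.
From mathcomp Require Import generic_quotient.
From mathcomp Require Import all_classical all_reals all_analysis.

Set Implicit Arguments.
Unset Strict Implicit.
Unset Printing Implicit Defensive.

Import Order.TTheory GRing.Theory Num.Theory.
Import numFieldNormedType.Exports.

Local Open Scope classical_set_scope.
Local Open Scope ring_scope.
Local Open Scope ereal_scope.

(* The free group on T, as reduced words. The letter (t, false) stands for the
   generator t, and (t, true) for its inverse. *)
Section FreeGroup.
Variable T : choiceType.
Notation letter := (T * bool)%type.

Definition inv_letter (a : letter) : letter := (a.1, ~~ a.2).

Definition reduced (w : seq letter) : bool :=
  sorted (fun a b => b != inv_letter a) w.

Definition push (a : letter) (w : seq letter) : seq letter :=
  if w is b :: w' then if b == inv_letter a then w' else a :: w else [:: a].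

(* the reduced form of u ++ v when v is reduced *)
Definition wmul (u v : seq letter) : seq letter := foldr push v u.

Definition winv (u : seq letter) : seq letter := rev (map inv_letter u).

Lemma inv_letterK : involutive inv_letter.
Proof. by case=> t b; rewrite /inv_letter /= negbK. Qed.

Lemma push_reduced a w : reduced w -> reduced (push a w).
Proof.
case: w => [//|b w] /= rbw; case: eqP => [_|/eqP ba] /=.
  exact: path_sorted rbw.
by rewrite ba.
Qed.

Lemma wmul_reduced u v : reduced v -> reduced (wmul u v).
Proof. by move=> rv; elim: u => //= a u; exact: push_reduced. Qed.

Lemma push_invK a w : reduced w -> push a (push (inv_letter a) w) = w.
Proof.
case: w => [_|b w rw] /=; first by rewrite eqxx.
rewrite inv_letterK; case: eqP => [ba|_]; last by rewrite /= eqxx.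
case: w rw => [|c w] /=; first by rewrite ba.
by case/andP=> cb _; rewrite ba in cb *; rewrite (negbTE cb).
Qed.

Lemma wmul_push a v u : reduced u -> wmul (push a v) u = push a (wmul v u).
Proof.
move=> ru; case: v => [//|b v] /=; case: eqP => // ->.
by rewrite push_invK //; exact: wmul_reduced.
Qed.

Lemma wmulA u v w : reduced w -> wmul u (wmul v w) = wmul (wmul u v) w.
Proof. by move=> rw; elim: u => //= a u ->; rewrite wmul_push. Qed.

Lemma push_cons a w : reduced (a :: w) -> push a w = a :: w.
Proof. by case: w => //= b w /andP[/negbTE ->]. Qed.

Lemma wmul0 u : reduced u -> wmul u [::] = u.
Proof.
elim: u => //= a u IH rau; rewrite IH ?push_cons //.
exact: path_sorted rau.
Qed.

Lemma wmulV u : wmul (winv u) u = [::].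
Proof.
elim: u => // a u IH.
by rewrite /winv /= rev_cons /wmul -cats1 foldr_cat /= inv_letterK eqxx.
Qed.

Lemma winvK : involutive winv.
Proof. by move=> u; rewrite /winv map_rev revK mapK //; exact: inv_letterK. Qed.

Lemma winv_reduced u : reduced u -> reduced (winv u).
Proof.
rewrite /reduced /winv rev_sorted sorted_map; apply: sub_sorted => a b /=.
by rewrite inv_letterK eq_sym.
Qed.

Record free_group := FreeGroup { word : seq letter; _ : reduced word }.

HB.instance Definition _ := [isSub for word].
HB.instance Definition _ := [Choice of free_group by <:].

Lemma word_reduced (x : free_group) : reduced (word x).
Proof. by case: x. Qed.

Definition fg_one : free_group := @FreeGroup [::] isT.
Definition fg_mul (x y : free_group) : free_group :=
  FreeGroup (wmul_reduced (word x) (word_reduced y)).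
Definition fg_inv (x : free_group) : free_group :=
  FreeGroup (winv_reduced (word_reduced x)).

Lemma fg_mulA : associative fg_mul.
Proof. by move=> x y z; apply: val_inj; apply: wmulA; exact: word_reduced. Qed.

Lemma fg_mul1g : left_id fg_one fg_mul.
Proof. by move=> x; exact: val_inj. Qed.

Lemma fg_mulg1 : right_id fg_one fg_mul.
Proof. by move=> x; apply: val_inj; apply: wmul0; exact: word_reduced. Qed.

Lemma fg_mulVg : left_inverse fg_one fg_inv fg_mul.
Proof. by move=> x; apply: val_inj; exact: wmulV. Qed.

Lemma fg_mulgV : right_inverse fg_one fg_inv fg_mul.
Proof.
move=> x; apply: val_inj => /=.
by rewrite -{1}[word x]winvK; exact: wmulV.
Qed.

HB.instance Definition _ :=
  isGroup.Build free_group fg_mulA fg_mul1g fg_mulg1 fg_mulVg fg_mulgV.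

End FreeGroup.

Definition F2 : groupType := free_group bool.

Section StandardProbability.
Context (R : realType) (d : measure_display) (X : measurableType d).

(* The Borel structure of X is that of a Polish topology, transported along a
   bijection f from a complete separable metric space Y. *)
Definition standard_borel : Prop :=
  exists (Y : completePseudoMetricType R) (f : X -> Y),
    [/\ hausdorff_space Y,
        exists2 D : set Y, countable D & dense D,
        bijective f
      & forall A : set X, measurable A <-> <<s @open Y >> (f @` A)].

Definition nonatomic (mu : probability X R) : Prop :=
  forall A, measurable A -> 0 < mu A ->
    exists B, [/\ measurable B, B `<=` A, 0 < mu B & mu B < mu A].

Definition standard_probability (mu : probability X R) : Prop :=
  standard_borel /\ nonatomic mu.

End StandardProbability.

Section Aut.
Context (R : realType) (d : measure_display) (X : measurableType d).
Variable mu : probability X R.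

Definition measure_preserving (T : X -> X) : Prop :=
  measurable_fun setT T /\ forall A, measurable A -> mu (T @^-1` A) = mu A.

(* On a standard Borel space the inverse of a Borel bijection is Borel
   (Lusin-Souslin), so its measurability is not required. *)
Record mp_bij := MpBij {
  mp_fun :> X -> X ;
  mp_fun_bij : bijective mp_fun ;
  mp_fun_mp : measure_preserving mp_fun }.

HB.instance Definition _ := gen_eqMixin mp_bij.
HB.instance Definition _ := gen_choiceMixin mp_bij.

Definition mp_ae_eq (S T : mp_bij) : bool := `[< {ae mu, forall x, S x = T x} >].

Let mp_ae_eq_refl : reflexive mp_ae_eq.
Proof. by move=> T; apply/asboolP; exact: aeW. Qed.

Let mp_ae_eq_sym : symmetric mp_ae_eq.
Proof. by move=> S T; apply/asboolP/asboolP; apply: filterS => x ->. Qed.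

Let mp_ae_eq_trans : transitive mp_ae_eq.
Proof.
move=> T S U /asboolP ST /asboolP TU; apply/asboolP.
by apply: filterS2 ST TU => x -> ->.
Qed.

Canonical mp_ae_eq_equiv :=
  EquivRel mp_ae_eq mp_ae_eq_refl mp_ae_eq_sym mp_ae_eq_trans.

Local Open Scope quotient_scope.

Definition Aut : Type := {eq_quot mp_ae_eq}.
HB.instance Definition _ := Choice.on Aut.
HB.instance Definition _ := EqQuotient.on Aut.
(* some representative of the class T, determined up to a null set *)
Definition Aut_fun (T : Aut) : X -> X := repr T.
Coercion Aut_fun : Aut >-> Funclass.

Lemma Aut_eqP (S T : Aut) : S = T <-> {ae mu, forall x, S x = T x}.
Proof.
split=> [->|ST]; first exact: aeW.
by rewrite -[S]reprK -[T]reprK; apply/eqmodP/asboolP.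
Qed.

End Aut.

Record pmp_action (G : groupType) (R : realType) (d : measure_display)
    (X : measurableType d) (mu : probability X R) := PmpAction {
  act :> G -> X -> X ;
  act1 : forall x, act 1%g x = x ;
  actM : forall g h x, act (g * h)%g x = act g (act h x) ;
  act_mp : forall g, measure_preserving mu (act g) }.

Section Words.
Variable G : groupType.

Definition word_in (S w : seq G) : bool :=
  all (fun s => (s \in S) || (s^-1%g \in S)) w.

Definition generates (S : seq G) : Prop :=
  forall g : G, exists2 w, word_in S w & foldr *%g 1%g w = g.

End Words.

Section L1.
Context (R : realType) (d : measure_display) (X : measurableType d).
Variable mu : probability X R.

Definition orbit (G : groupType) (a : pmp_action G mu) (x : X) : set X :=
  [set y | exists g, y = a g x].

(* With w = [:: s_1; ...; s_n] the foldl below is a s_n (... (a s_1 x)).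
   The value is +oo when y is not in the orbit of x. *)
Definition schreier_dist (G : groupType) (S : seq G) (a : pmp_action G mu)
    (x y : X) : \bar R :=
  ereal_inf [set ((size w)%:R)%:E | w in
    [set w : seq G | word_in S w /\ foldl (fun z s => a s z) x w = y]].

Definition L1_full_group (G : groupType) (S : seq G) (a : pmp_action G mu) :
    set (Aut mu) :=
  [set T : Aut mu | {ae mu, forall x, orbit a x (T x)} /\
                    \int[mu]_x schreier_dist S a x (T x) < +oo].

Definition id_L1_orbit_equivalence (G H : groupType) (S : seq G) (S' : seq H)
    (a : pmp_action G mu) (b : pmp_action H mu) : Prop :=
  [/\ {ae mu, forall x, orbit a x = orbit b x},
      forall h : H, mu.-integrable setT (fun x => schreier_dist S a x (b h x))
    & forall g : G, mu.-integrable setT (fun x => schreier_dist S' b x (a g x))].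

End L1.

(* Main.v *)
Require Import Defs.
From HB Require Import structures.
From mathcomp Require Import all_boot all_order all_algebra.
From mathcomp Require Import all_classical all_reals all_analysis.
From mathcomp Require Import measurable_realfun.
From mathcomp Require Import zify ring lra.

(** The two actions have finite orbits and live on the line, cut into the unit
    intervals [n, n + 1) for n a natural number; negative reals have measure 0
    and do not move.  A permutation h of nat that fixes 0 acts by translating
    interval n onto interval h n, and it preserves the measure as soon as
    interval h n weighs as much as interval n.  An action of F_2 is thus given
    by two weight-preserving involutions of nat, one for each generator, and
    distances in an orbit are distances in a graph on nat.

    Cut nat into the dyadic blocks [2^k - 1, 2^(k+1) - 1).  In the first graph
    every block is a cycle, in the second the same cycle with one edge removed,
    that is a path.  In both of them the first generator [rung] swaps the
    endpoints of every other edge of the block, and the second generator swaps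
    the endpoints of the remaining ones ([cycle_swap], [path_swap]).  The
    endpoints of the missing edge are 2^k - 1 apart in the path.  All intervals
    of the blocks 2j and 2j + 1 get weight 8^-j / 6.

    The identity is an L^1 orbit equivalence.  The only unbounded cost is that
    of the missing edges, of order 4^j on four intervals of weight 8^-j / 6 for
    every j, and the sum of 4^j / 8^j converges.  It is enough to look at the
    generators: by the triangle inequality the cost of a word is at most the
    sum of the costs of its letters, each evaluated along an orbit, and the
    actions preserve the measure ([integral_schreier_dist_letters]).

    The full groups differ.  The involution [fold_end] exchanges the first 2^j
    and the last 2^j intervals of block 2j by the reflection of that block.  In
    the cycle it moves points by less than 2^(j+1), through the edge that the
    path lacks; the cost over block 2j is of order 2^j * 2^j / 8^j = 2^-j, and
    [fold_end] is in the first L^1 full group.  In the path it moves these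
    points by at least 4^j - 2 * 2^j; the cost over block 2j is of order
    2^j * 4^j / 8^j = 1, and the series diverges. *)

Set Implicit Arguments.
Unset Strict Implicit.
Unset Printing Implicit Defensive.

Import Order.TTheory GRing.Theory Num.Theory.
Import numFieldNormedType.Exports.

(** * The path and the cycle on dyadic blocks *)
Section Blocks.
Local Open Scope nat_scope.

Definition pow2 n := n == 2 ^ trunc_log 2 n.

Lemma pow2P n : reflect (exists k, n = 2 ^ k) (pow2 n).
Proof.
apply: (iffP eqP) => [->|[k ->]]; first by exists (trunc_log 2 n).
by rewrite trunc_expnK.
Qed.

Lemma pow2_double n : pow2 n.*2 = pow2 n.
Proof.
apply/pow2P/pow2P => -[k nk]; last by exists k.+1; rewrite nk expnS mul2n.
case: k nk => [|k]; first by lia.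
by rewrite expnS => nk; exists k; lia.
Qed.

Lemma pow2_odd n : odd n -> pow2 n -> n = 1.
Proof.
by move=> on /pow2P[[|k] nk]; rewrite nk // oddX in on.
Qed.

Lemma pow2_between k n : 2 ^ k < n < 2 ^ k.+1 -> ~~ pow2 n.
Proof.
move=> /andP[kn nk]; apply/pow2P => -[i ni]; move: kn nk.
by rewrite ni !ltn_exp2l // => ki; rewrite ltnS leqNgt ki.
Qed.

(** A block begins at n when n.+1 is a power of two, and ends at n when n.+2 is.
    The edge from n to n.+1 inside a block belongs to [rung] when n is odd and
    to the second generator when n is even.  Blocks other than {0} have even
    length and begin at an odd number, so both of their ends are fixed by
    [path_swap]; [cycle_swap] exchanges these two ends, n.*2 being the end of
    the block that begins at n. *)
Definition rung n := if odd n then n.+1 else n.-1.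

Definition path_swap n :=
  if odd n then if pow2 n.+1 then n else n.-1
  else if pow2 n.+2 then n else n.+1.

Definition cycle_swap n :=
  if odd n then if pow2 n.+1 then n.*2 else n.-1
  else if pow2 n.+2 then n./2 else n.+1.

Lemma rungK : involutive rung.
Proof.
move=> [//|n]; rewrite /rung /=.
by case: (boolP (odd n)) => on /=; rewrite ?on ?(negbTE on).
Qed.

Lemma path_swapK : involutive path_swap.
Proof.
move=> n; rewrite /path_swap; case on: (odd n).
  case: n on => // n on; case pn: (pow2 n.+2); first by rewrite on pn.
  by rewrite [n.+1.-1]/= -[odd n]negbK -[~~ odd n]/(odd n.+1) on pn.
by case pn: (pow2 n.+2); rewrite /= on pn.
Qed.

Lemma cycle_swapK : involutive cycle_swap.
Proof.
move=> n; rewrite /cycle_swap; case on: (odd n).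
  case: n on => // n on; case pn: (pow2 n.+2).
    by rewrite odd_double -doubleS pow2_double pn doubleK.
  by rewrite [n.+1.-1]/= -[odd n]negbK -[~~ odd n]/(odd n.+1) on pn.
case pn: (pow2 n.+2); last by rewrite /= on pn.
have nE : n = n./2.*2 by rewrite -[LHS]odd_double_half on.
move: pn; rewrite nE -doubleS pow2_double doubleK => pn.
case om: (odd n./2); first by rewrite pn.
(* {0} is the only block that begins at an even number. *)
by have /= := pow2_odd _ pn; rewrite om => /(_ isT) [->].
Qed.

(** Level j consists of the two blocks 2j and 2j + 1, so that levels grow by a
    factor 4 and the width 2^j of [fold_end] is the square root of the length
    of block 2j. *)
Definition level n := trunc_log 4 n.+1.

Lemma level_bounds n : 4 ^ level n <= n.+1 < 4 ^ (level n).+1.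
Proof. by apply: trunc_log_bounds. Qed.

Lemma level_eq j n : 4 ^ j <= n.+1 < 4 ^ j.+1 -> level n = j.
Proof. by move=> jn; apply: trunc_log_eq. Qed.

Lemma exp4 j : 4 ^ j = 2 ^ j.*2.
Proof. by rewrite -[4]/(2 ^ 2) -expnM mul2n. Qed.

Lemma pow4_pow2 j : pow2 (4 ^ j).
Proof. by apply/pow2P; exists j.*2; rewrite exp4. Qed.

Lemma pow2_level n : pow2 n.+1 ->
  n.+1 = 4 ^ level n \/ n.+1 = 2 * 4 ^ level n.
Proof.
move=> /pow2P[k nk].
have : 4 ^ k./2 <= n.+1 < 4 ^ (k./2).+1.
  by rewrite nk !exp4 leq_exp2l // ltn_exp2l //; lia.
move=> /level_eq ->; rewrite nk exp4 -expnS.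
have := odd_double_half k; case: (odd k) => /= kE; last by left; rewrite -{1}kE.
by right; rewrite -{1}kE.
Qed.

Lemma levelS n : ~~ pow2 n.+2 -> level n.+1 = level n.
Proof.
move=> np; apply: level_eq; have := level_bounds n => /andP[n1 n2].
rewrite (leq_trans n1) //= ltn_neqAle n2 andbT.
by apply: contra np => /eqP ->; exact: pow4_pow2.
Qed.

(** If n is odd, n.+2 is odd too, so that no block ends at n. *)
Lemma level_rung n : level (rung n) = level n.
Proof.
suff H m : odd m -> level m.+1 = level m.
  case: n => [//|n]; rewrite /rung; case: ifP => [/H //|/= on].
  by rewrite -H // -[odd n]negbK on.
by move=> om; apply: levelS; apply/negP => /pow2_odd /=; rewrite negbK => /(_ om).
Qed.

Lemma level_path_swap n : level (path_swap n) = level n.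
Proof.
rewrite /path_swap; case on: (odd n).
  by case: n on => // n on; case pn: (pow2 n.+2) => //; rewrite levelS // pn.
by case pn: (pow2 n.+2) => //; rewrite levelS // pn.
Qed.

Lemma level_double n : pow2 n.+1 -> level n.*2 = level n.
Proof.
move=> /pow2_level nE; apply: level_eq; have := level_bounds n.
by rewrite expnS; lia.
Qed.

Lemma level_cycle_swap n : level (cycle_swap n) = level n.
Proof.
rewrite /cycle_swap; case on: (odd n); case: ifP => pn.
- exact: level_double.
- by case: n on pn => // n on pn; rewrite levelS // pn.
- have nE : n = n./2.*2 by rewrite -[LHS]odd_double_half on.
  by move: pn; rewrite nE -doubleS pow2_double doubleK => /level_double ->.
- by rewrite levelS // pn.
Qed.

(** For n of level j: the 2^j intervals at either end of block 2j, which is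
    [4^j - 1, 2 * 4^j - 1).  Block 2j + 1 never qualifies. *)
Definition near_end n :=
  let j := level n in
  (n.+1 < 4 ^ j + 2 ^ j) || (2 * 4 ^ j - 2 ^ j <= n.+1 < 2 * 4 ^ j).

Definition fold_end n := if near_end n then 3 * 4 ^ level n - 3 - n else n.

Lemma exp2_le4 j : 2 ^ j <= 4 ^ j.
Proof. by case: j => // j; rewrite leq_exp2r. Qed.

Lemma level_fold_end n : level (fold_end n) = level n.
Proof.
rewrite /fold_end /near_end; case: ifP => // H; apply: level_eq.
by have := level_bounds n; have := exp2_le4 (level n); rewrite expnS; lia.
Qed.

Lemma fold_endK : involutive fold_end.
Proof.
move=> n; rewrite {1}/fold_end /near_end level_fold_end.
have := level_bounds n; have := exp2_le4 (level n); rewrite expnS.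
rewrite /fold_end /near_end; move: (4 ^ _) (2 ^ _) => a b.
by case: ifP; case: ifP; lia.
Qed.

Definition gap m n := (m - n) + (n - m).

(** ** Walks and their lengths *)
Section Walks.
Variable s : bool -> nat -> nat.

Definition walk n k m :=
  exists2 ls : seq bool, foldl (fun z l => s l z) n ls = m & size ls <= k.

Lemma walk_le n k k' m : k <= k' -> walk n k m -> walk n k' m.
Proof. by move=> kk [ls ? lk]; exists ls => //; exact: leq_trans kk. Qed.

Lemma walk_refl n k : walk n k n.
Proof. by exists [::]. Qed.

Lemma walk_step l n : walk n 1 (s l n).
Proof. by exists [:: l]. Qed.

Lemma walk_trans p n k m k' : walk n k p -> walk p k' m -> walk n (k + k') m.
Proof.
move=> [u <- uk] [v <- vk]; exists (u ++ v); first by rewrite foldl_cat.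
by rewrite size_cat leq_add.
Qed.

Hypothesis sK : forall l, involutive (s l).

Lemma walk_sym n k m : walk n k m -> walk m k n.
Proof.
move=> [ls <- lk]; exists (rev ls); last by rewrite size_rev.
elim: ls n {lk} => //= l ls IH n.
by rewrite rev_cons -cats1 foldl_cat IH /= sK.
Qed.

(** The edges shared by the path and the cycle: all pairs of neighbours inside
    a block. *)
Hypothesis climb : forall i, ~~ pow2 i.+2 -> exists l, s l i = i.+1.

Lemma walk_climb n m : n <= m -> (forall i, n <= i < m -> ~~ pow2 i.+2) ->
  walk n (m - n) m.
Proof.
move=> nm; rewrite -{1 3}(subnKC nm).
elim: (m - n) => [|k IH] H; first by rewrite addn0; exact: walk_refl.
rewrite -[in walk _ k.+1]addn1; apply: (@walk_trans (n + k)).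
  by apply: IH => i ik; apply: H; lia.
have /climb[l ln] : ~~ pow2 (n + k).+2 by apply: H; lia.
by rewrite addnS -ln; exact: walk_step.
Qed.

Lemma walk_dyadic k n m : 2 ^ k <= n.+1 -> n <= m -> m.+1 < 2 ^ k.+1 ->
  walk n (m - n) m.
Proof.
move=> kn nm mk; apply: walk_climb => // i inm.
by apply: (@pow2_between k); lia.
Qed.

End Walks.

Definition path_gen (l : bool) := if l then path_swap else rung.
Definition cycle_gen (l : bool) := if l then cycle_swap else rung.

Lemma path_genK l : involutive (path_gen l).
Proof. by case: l; [exact: path_swapK|exact: rungK]. Qed.

Lemma cycle_genK l : involutive (cycle_gen l).
Proof. by case: l; [exact: cycle_swapK|exact: rungK]. Qed.

Lemma path_gen_climb i : ~~ pow2 i.+2 -> exists l, path_gen l i = i.+1.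
Proof.
move=> ip; exists (~~ odd i); rewrite /path_gen /rung /path_swap.
by case on: (odd i); rewrite /= ?on ?(negbTE ip).
Qed.

Lemma cycle_gen_climb i : ~~ pow2 i.+2 -> exists l, cycle_gen l i = i.+1.
Proof.
move=> ip; exists (~~ odd i); rewrite /cycle_gen /rung /cycle_swap.
by case on: (odd i); rewrite /= ?on ?(negbTE ip).
Qed.

(** In the path, the edge that closes a block into a cycle is replaced by a walk
    through the whole block. *)
Lemma walk_path_double m : pow2 m.+1 -> walk path_gen m m m.*2.
Proof.
move=> /pow2P[k mk]; have {2}-> : m = m.*2 - m by lia.
by apply: (walk_dyadic path_gen_climb (k := k)); rewrite ?expnS; lia.
Qed.

(** The gap is the exact price of a generator of the cycle in the path: 1 along
    a shared edge, and the length of the path across the missing one. *)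
Lemma walk_cycle_swap n :
  walk path_gen n (gap (cycle_swap n) n) (cycle_swap n).
Proof.
rewrite /cycle_swap; case on: (odd n); case pn: (pow2 _).
- apply: walk_le (walk_path_double pn); rewrite /gap; lia.
- have <- : path_swap n = n.-1 by rewrite /path_swap on pn.
  apply: walk_le (walk_step _ true n).
  by rewrite /= /path_swap on pn /gap; case: (n) on => // k _ /=; lia.
- have nE : n = n./2.*2 by rewrite -[LHS]odd_double_half on.
  move: pn; rewrite {1}nE -doubleS pow2_double => /walk_path_double.
  move=> /(walk_sym path_genK); rewrite -nE; apply: walk_le; rewrite /gap; lia.
- have <- : path_swap n = n.+1 by rewrite /path_swap on pn.
  apply: walk_le (walk_step _ true n).
  by rewrite /= /path_swap on pn /gap; lia.
Qed.

Definition fold_cost n := if near_end n then 2 ^ (level n).+1 else 0.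

(** A point at distance i from the beginning of block 2j walks there in i steps,
    crosses the closing edge of the cycle and walks i steps back from the end;
    2i + 1 < 2^(j+1) since i < 2^j. *)
Lemma walk_fold_end n : walk cycle_gen n (fold_cost n) (fold_end n).
Proof.
(* The two ends play symmetric roles: fold_end is an involution. *)
suff H m : m.+1 < 4 ^ level m + 2 ^ level m ->
    walk cycle_gen m (2 ^ (level m).+1) (fold_end m).
  rewrite /fold_cost; case: ifPn => [|/negbTE nn]; last first.
    by rewrite /fold_end nn; exact: walk_refl.
  have [n1 _|n1 /= n2] := boolP (n.+1 < 4 ^ level n + 2 ^ level n).
    exact: H.
  have := H (fold_end n); rewrite level_fold_end fold_endK => H'.
  apply: (walk_sym cycle_genK); apply: H'.
  move: n2; rewrite /fold_end /near_end (negbTE n1) /= => n2.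
  rewrite n2; have := level_bounds n; have := exp2_le4 (level n).
  by move: n2; rewrite expnS; move: (4 ^ _) (2 ^ _) => a b; lia.
move=> mj; rewrite /fold_end /near_end mj /=.
have := level_bounds m; move: (level m) mj => j mj mb.
have ej : 4 ^ j = 2 ^ j.*2 := exp4 j.
have e2 : 2 ^ j.*2.+1 = 2 * 4 ^ j by rewrite expnS ej.
have l24 := exp2_le4 j.
have w1 : walk cycle_gen (4 ^ j).-1 (m - (4 ^ j).-1) m.
  by apply: (walk_dyadic cycle_gen_climb (k := j.*2)); lia.
have w2 : walk cycle_gen (4 ^ j).-1 1 (2 * 4 ^ j - 2).
  have [->|j0] := posnP j; first exact: walk_refl.
  have -> : 2 * 4 ^ j - 2 = cycle_gen true (4 ^ j).-1; last exact: walk_step.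
  rewrite /= /cycle_swap; have -> : odd (4 ^ j).-1.
    have : ~~ odd (4 ^ j) by rewrite oddX; case: (j) j0.
    by lia.
  have -> : (4 ^ j).-1.+1 = 4 ^ j by lia.
  by rewrite pow4_pow2; lia.
have w3 : walk cycle_gen (3 * 4 ^ j - 3 - m)
    ((2 * 4 ^ j - 2) - (3 * 4 ^ j - 3 - m)) (2 * 4 ^ j - 2).
  by apply: (walk_dyadic cycle_gen_climb (k := j.*2)); lia.
apply: walk_le (walk_trans (walk_sym cycle_genK w1)
  (walk_trans w2 (walk_sym cycle_genK w3))).
by rewrite expnS; lia.
Qed.

(** This makes the gap a lower bound for distances in the path. *)
Lemma gap_path_gen l n : gap (path_gen l n) n <= 1.
Proof.
rewrite /gap /path_gen /path_swap /rung.
by case: l; case: (odd n); try case: ifP; lia.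
Qed.

Lemma level_block j n : (4 ^ j).-1 <= n < (4 ^ j.+1).-1 -> level n = j.
Proof. by move=> H; apply: level_eq; lia. Qed.

Lemma sum_window a b p q :
  \sum_(a <= n < b) (p <= n.+1 < q) <= q - p.
Proof.
apply: (@leq_trans (minn q b.+1 - p)); last by lia.
elim: b => [|b IH]; first by rewrite big_geq.
have [ab|ab] := leqP a b; last by rewrite big_geq.
by rewrite big_nat_recr //=; lia.
Qed.

(** Level j has 3 * 4^j points.  Their gap is at most 1, except at the four ends
    of the two blocks, where it is less than 4^(j+1): hence 19 = 3 + 4 * 4. *)
Lemma sum_wrap_cost j :
  \sum_((4 ^ j).-1 <= n < (4 ^ j.+1).-1) gap (cycle_swap n) n <= 19 * 4 ^ j.
Proof.
(* The indicator of n.+1 = v, written as a window to be summed by sum_window;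
   the four ends of blocks have n.+1 equal to one of the four values below. *)
pose w v n : nat := v <= n.+1 < v.+1.
apply: (@leq_trans (\sum_((4 ^ j).-1 <= n < (4 ^ j.+1).-1)
  (1 + 4 ^ j.+1 * (w (4 ^ j) n + w (2 * 4 ^ j) n + w (2 * 4 ^ j).-1 n
                   + w (4 ^ j.+1).-1 n)))).
  rewrite !big_nat; apply: leq_sum => n nj; have nl := level_block nj.
  rewrite /gap /cycle_swap; case on: (odd n); case pn: (pow2 _).
  - have := pow2_level pn; rewrite nl /w => -[] nE.
      by rewrite nE leqnn ltnSn /=; lia.
    by rewrite nE leqnn ltnSn /=; lia.
  - lia.
  - have [nend|nin] := eqVneq n.+2 (4 ^ j.+1).
      by rewrite /w -nend /= leqnn ltnSn /=; lia.
    have := pow2_level pn; rewrite (level_eq (j := j)) => [[] nE|]; last by lia.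
      by rewrite /w; lia.
    by rewrite /w -nE /= leqnn ltnSn /=; lia.
  - lia.
rewrite big_split /= sum_nat_const_nat -big_distrr /= !big_split /=.
have W v : \sum_((4 ^ j).-1 <= n < (4 ^ j.+1).-1) w v n <= 1.
  by apply: leq_trans (sum_window _ _ _ _) _; lia.
move: (W (4 ^ j)) (W (2 * 4 ^ j)) (W (2 * 4 ^ j).-1) (W (4 ^ j.+1).-1).
move: (bigop.body _ _ _) (bigop.body _ _ _) (bigop.body _ _ _) (bigop.body _ _ _).
by move=> a b c d; rewrite expnS; nia.
Qed.

Lemma sum_fold_cost j :
  \sum_((4 ^ j).-1 <= n < (4 ^ j.+1).-1) fold_cost n <= 4 * 4 ^ j.
Proof.
apply: (@leq_trans (\sum_((4 ^ j).-1 <= n < (4 ^ j.+1).-1)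
  2 ^ j.+1 * ((4 ^ j <= n.+1 < 4 ^ j + 2 ^ j) +
              (2 * 4 ^ j - 2 ^ j <= n.+1 < 2 * 4 ^ j)))).
  rewrite !big_nat; apply: leq_sum => n nj; have nl := level_block nj.
  rewrite /fold_cost /near_end nl; case: ifP => //.
  move: (2 ^ _.+1) => c; have -> : 4 ^ j <= n.+1 by lia.
  by case: (n.+1 < _ + _) => /= [_|->]; lia.
rewrite -big_distrr /= !big_split /=.
have e : 4 ^ j = 2 ^ j * 2 ^ j by rewrite -expnMn.
have := sum_window (4 ^ j).-1 (4 ^ j.+1).-1 (4 ^ j) (4 ^ j + 2 ^ j).
have := sum_window (4 ^ j).-1 (4 ^ j.+1).-1 (2 * 4 ^ j - 2 ^ j) (2 * 4 ^ j).
have := exp2_le4 j; rewrite [2 ^ j.+1]expnS.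
move: (\sum_(_ <= _ < _) _) (\sum_(_ <= _ < _) _) => a b.
by nia.
Qed.

(** The 2^j points at the beginning of block 2j suffice; each has a gap of at
    least 4^j - 2 * 2^j, which is at least half of 4^j as soon as 2 <= j. *)
Lemma sum_gap_fold_end j : 2 <= j ->
  8 ^ j <= 2 * \sum_((4 ^ j).-1 <= n < (4 ^ j.+1).-1) gap (fold_end n) n.
Proof.
move=> j2; have l24 := exp2_le4 j.
have e4 : 4 ^ j = 2 ^ j * 2 ^ j by rewrite -expnMn.
have e8 : 8 ^ j = 2 ^ j * 4 ^ j by rewrite -expnMn.
have g4 : 2 ^ 2 <= 2 ^ j by rewrite leq_exp2l.
rewrite (@big_cat_nat _ _ _ ((4 ^ j).-1 + 2 ^ j)) /=; [|lia|rewrite expnS; lia].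
apply: (@leq_trans (2 * \sum_((4 ^ j).-1 <= n < (4 ^ j).-1 + 2 ^ j)
   (4 ^ j - 2 * 2 ^ j))).
  by rewrite sum_nat_const_nat addKn; nia.
rewrite leq_mul2l /=; apply: leq_trans (leq_addr _ _).
rewrite !big_nat; apply: leq_sum => n nj.
have nl : level n = j by apply: level_block; rewrite expnS; lia.
rewrite /fold_end /near_end nl; have -> : n.+1 < 4 ^ j + 2 ^ j by lia.
by rewrite /gap /=; lia.
Qed.

End Blocks.

Local Open Scope classical_set_scope.
Local Open Scope ring_scope.
Local Open Scope ereal_scope.

(** * Weighted sums over levels *)
Section WeightedSums.
Variable R : realType.

(** The factor 1 / 6 makes the total weight, the sum of 3 * 4^j * 8^-j / 6, equal
    to 1. *)
Definition weight n : R := (8 ^- level n / 6)%R.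

Lemma weight_ge0 n : (0 <= weight n)%R.
Proof. by rewrite /weight divr_ge0 // invr_ge0 exprn_ge0. Qed.

Lemma weighted_block_sum (F : nat -> nat) j :
  (\sum_((4 ^ j).-1 <= n < (4 ^ j.+1).-1) weight n * (F n)%:R =
   8 ^- j / 6 * (\sum_((4 ^ j).-1 <= n < (4 ^ j.+1).-1) F n)%:R)%R.
Proof.
rewrite natr_sum big_distrr /=; rewrite !big_nat; apply: eq_bigr => n nj.
by rewrite /weight (level_block nj).
Qed.

Lemma big_block_recr (F : nat -> R) k :
  (\sum_(0 <= n < (4 ^ k.+1).-1) F n = \sum_(0 <= n < (4 ^ k).-1) F n +
   \sum_((4 ^ k).-1 <= n < (4 ^ k.+1).-1) F n)%R.
Proof. by rewrite (@big_cat_nat _ _ _ (4 ^ k).-1) //= expnS; lia. Qed.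

Lemma pow_4_8 k : (4 ^+ k / 8 ^+ k = 2 ^- k :> R)%R.
Proof. by rewrite -expr_div_n -exprVn; congr (_ ^+ k)%R; lra. Qed.

(** Level j contributes at most D / 6 * 2^-j, and the bound is the partial sum of
    this geometric series. *)
Lemma weighted_sum_le (F : nat -> nat) D k :
  (forall j, (\sum_((4 ^ j).-1 <= n < (4 ^ j.+1).-1) F n <= D * 4 ^ j)%N) ->
  (\sum_(0 <= n < (4 ^ k).-1) weight n * (F n)%:R <=
   D%:R / 3 * (1 - 2 ^- k))%R.
Proof.
move=> FD; elim: k => [|k IH].
  by rewrite big_geq // expr0 invr1 subrr mulr0.
rewrite big_block_recr weighted_block_sum.
have : (8 ^- k / 6 * (\sum_((4 ^ k).-1 <= n < (4 ^ k.+1).-1) F n)%:R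
        <= 8 ^- k / 6 * (D * 4 ^ k)%:R :> R)%R.
  by rewrite ler_wpM2l ?ler_nat // divr_ge0 // invr_ge0 exprn_ge0.
rewrite natrM natrX.
have -> : (8 ^- k / 6 * (D%:R * 4 ^+ k) = D%:R / 6 * (4 ^+ k / 8 ^+ k) :> R)%R.
  by field; rewrite expf_neq0.
rewrite pow_4_8 exprS invfM => H; apply: le_trans (lerD IH H) _.
by rewrite le_eqVlt; apply/orP; left; apply/eqP; field.
Qed.

(** The equality case of [weighted_sum_le], for F = 1 and D = 3. *)
Lemma weight_sum k :
  (\sum_(0 <= n < (4 ^ k).-1) weight n = 1 - 2 ^- k)%R.
Proof.
elim: k => [|k IH]; first by rewrite big_geq // expr0 invr1 subrr.
rewrite big_block_recr IH.
under [X in (_ + X)%R]eq_bigr do rewrite -[weight _]mulr1.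
rewrite (weighted_block_sum (fun=> 1%N)) sum_nat_const_nat muln1.
have -> : ((4 ^ k.+1).-1 - (4 ^ k).-1 = 3 * 4 ^ k)%N by rewrite expnS; lia.
rewrite natrM natrX.
have -> : (8 ^- k / 6 * (3 * 4 ^+ k) = (4 ^+ k / 8 ^+ k) / 2 :> R)%R.
  by field; rewrite expf_neq0.
by rewrite pow_4_8 exprS invfM; field.
Qed.

Lemma weighted_series_le (F : nat -> nat) D :
  (forall j, (\sum_((4 ^ j).-1 <= n < (4 ^ j.+1).-1) F n <= D * 4 ^ j)%N) ->
  \sum_(n <oo) (weight n * (F n)%:R)%:E <= (D%:R / 3)%:E.
Proof.
move=> FD.
have F0 n : 0 <= (weight n * (F n)%:R)%:E by rewrite lee_fin mulr_ge0 ?weight_ge0.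
apply: lime_le; first by apply: is_cvg_nneseries.
apply: nearW => k; rewrite sumEFin lee_fin.
apply: (@le_trans _ _ (\sum_(0 <= n < (4 ^ k).-1) weight n * (F n)%:R)%R).
  have kk : (k <= (4 ^ k).-1)%N by have := ltn_expl k (isT : (1 < 4)%N); lia.
  rewrite (big_cat_nat _ kk) //= lerDl; apply: sumr_ge0 => n _.
  by rewrite mulr_ge0 // weight_ge0.
apply: le_trans (weighted_sum_le _ FD) _.
by rewrite ler_piMr ?divr_ge0 // lerBlDr lerDl invr_ge0 exprn_ge0.
Qed.

Lemma weight_series : \sum_(n <oo) (weight n)%:E = 1.
Proof.
have W0 n : 0 <= (weight n)%:E by rewrite lee_fin weight_ge0.
apply/eqP; rewrite eq_le; apply/andP; split.
  have := @weighted_series_le (fun=> 1%N) 3.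
  under eq_eseriesr do rewrite mulr1.
  rewrite divff // => -> // j; rewrite sum_nat_const_nat muln1 expnS; lia.
apply/lee_addgt0Pr => e e0.
have [k ke] : exists k, (2 ^- k < e)%R.
  exists (Num.Def.archi_bound e^-1); rewrite invf_plt ?posrE ?exprn_gt0 //.
  exact: upper_nthrootP.
apply: (@le_trans _ _ ((1 - 2 ^- k + e)%:E)); first by rewrite lee_fin; lra.
rewrite EFinD leeD2r // -weight_sum -sumEFin.
exact: nneseries_lim_ge.
Qed.

(** Each level from 2 on contributes at least 1 / 12. *)
Lemma weighted_sum_ge (F : nat -> nat) k :
  (forall j, (2 <= j)%N ->
    (8 ^ j <= 2 * \sum_((4 ^ j).-1 <= n < (4 ^ j.+1).-1) F n)%N) ->
  (k%:R / 12 <= \sum_(0 <= n < (4 ^ k.+2).-1) weight n * (F n)%:R)%R.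
Proof.
move=> FD; elim: k => [|k IH].
  by rewrite mul0r sumr_ge0 // => n _; rewrite mulr_ge0 // weight_ge0.
rewrite big_block_recr weighted_block_sum -natr1 mulrDl lerD // mul1r.
have := FD k.+2 isT; rewrite -(ler_nat R) natrM natrX => H.
rewrite -mulrA ler_pdivlMl ?exprn_gt0 //; lra.
Qed.

Lemma weighted_series_infty (F : nat -> nat) :
  (forall j, (2 <= j)%N ->
    (8 ^ j <= 2 * \sum_((4 ^ j).-1 <= n < (4 ^ j.+1).-1) F n)%N) ->
  \sum_(n <oo) (weight n * (F n)%:R)%:E = +oo.
Proof.
move=> FD; apply/eqyP => A A0.
pose k := Num.Def.archi_bound (A * 12).
have Ak : (A * 12 <= k%:R)%R by rewrite ltW // archi_boundP // mulr_ge0 // ltW.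
apply: (@le_trans _ _ (\sum_(0 <= n < (4 ^ k.+2).-1) (weight n * (F n)%:R)%:E)).
  rewrite sumEFin lee_fin (le_trans _ (weighted_sum_ge k FD)) //.
  by rewrite ler_pdivlMr.
by apply: nneseries_lim_ge => n _ _; rewrite lee_fin mulr_ge0 ?weight_ge0.
Qed.

End WeightedSums.

(** * The measure on the line *)
Section FiberedLine.
Variable R : realType.
Let X := measurableTypeR R.

(** The floor takes countably many values, each on an interval; hence any map that
    factors through it is measurable. *)
Lemma measurable_floor_preimage (P : set int) :
  measurable [set x : X | P (Num.floor (x : R))].
Proof.
rewrite (_ : [set _ | _] =
    \bigcup_(i : int) (if `[< P i >] then `[i%:~R, (i + 1)%:~R[%classic
                       else set0)); last first.
  apply/seteqP; split => [x /= Px|x [i _]].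
    exists (Num.floor x) => //; move/asboolP : (Px) => ->.
    by rewrite /= in_itv /= floor_le_tmp floorD1_gt.
  case: asboolP => //= Pi; rewrite in_itv /= => ix.
  by rewrite (floor_def ix).
apply: countable_bigcupT_measurable => [|i]; first exact: countableP.
by case: ifP => // _; exact: measurable_itv.
Qed.

Lemma measurable_fun_floor d (Y : measurableType d) (g : int -> Y) :
  measurable_fun [set: X] (fun x => g (Num.floor (x : R))).
Proof.
by move=> _ A mA; rewrite setTI; exact: (measurable_floor_preimage (g @^-1` A)).
Qed.

Lemma measurable_fun_truncn d (Y : measurableType d) (g : nat -> Y) :
  measurable_fun [set: X] (fun x => g (Num.truncn (x : R))).
Proof.
have := measurable_fun_floor (fun i => g (if i is Posz n then n else 0%N)).
by under eq_fun do rewrite -truncEfloor.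
Qed.

(** The fractional part of u, carried to interval n.  With it, rather than with
    u + n, the point lies in interval n for every real u, and the identities
    below hold everywhere instead of almost everywhere. *)
Definition fiber n (u : X) : X := (u - (Num.floor (u : R))%:~R + n%:R)%R.

Lemma truncn_fiber n u : Num.truncn (fiber n u : R) = n.
Proof.
by apply: truncn_def; rewrite /fiber; have := floor_itv u; rewrite -natr1; lra.
Qed.

Lemma measurable_fiber n : measurable_fun [set: X] (fiber n).
Proof.
apply: measurable_funD => //; apply: measurable_funB => //.
exact: (measurable_fun_floor (fun i => i%:~R : X)).
Qed.

HB.instance Definition _ n := isMeasurableFun.Build _ _ _ _ _ (measurable_fiber n).

(** The truncation of a negative real is 0: when h fixes 0, this map is the
    identity on negative reals, and it is functorial in h on the whole line. *)
Definition fiberwise (h : nat -> nat) (x : X) : X :=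
  (x + (h (Num.truncn (x : R)))%:R - (Num.truncn (x : R))%:R)%R.

Lemma measurable_fiberwise h : measurable_fun [set: X] (fiberwise h).
Proof.
apply: measurable_funB; last exact: (measurable_fun_truncn (fun n => n%:R : X)).
apply: measurable_funD => //.
exact: (measurable_fun_truncn (fun n => (h n)%:R : X)).
Qed.

Lemma fiberwise_fiber h n u : fiberwise h (fiber n u) = fiber (h n) u.
Proof. by rewrite /fiberwise truncn_fiber /fiber; lra. Qed.

Lemma eq_fiberwise h k x :
  h (Num.truncn (x : R)) = k (Num.truncn (x : R)) -> fiberwise h x = fiberwise k x.
Proof. by rewrite /fiberwise => ->. Qed.

Lemma fiberwise_id x : fiberwise id x = x.
Proof. by rewrite /fiberwise addrK. Qed.

Lemma truncn_fiberwise h x : h 0%N = 0%N ->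
  Num.truncn (fiberwise h x : R) = h (Num.truncn (x : R)).
Proof.
move=> h0; have [x0|x0] := leP 0%R (x : R).
  by apply: truncn_def; have := truncn_itv x0; rewrite /fiberwise -!natr1; lra.
have x0' : Num.truncn (x : R) = 0%N.
  by apply/truncn0Pn; rewrite -ltNge; exact: lt_trans x0 ltr01.
by rewrite /fiberwise x0' h0 addrK x0'.
Qed.

Lemma fiberwise_comp h k x : k 0%N = 0%N ->
  fiberwise h (fiberwise k x) = fiberwise (h \o k) x.
Proof. by move=> k0; rewrite {1}/fiberwise truncn_fiberwise // /fiberwise /=; lra. Qed.

Definition unit_prob : probability X R := uniform_prob (@ltr01 R).

Definition weight_nng n : {nonneg R} := NngNum (weight_ge0 R n).

Definition blocks_measure : set X -> \bar R :=
  mseries (fun n => mscale (weight_nng n) (distribution unit_prob (fiber n))) 0.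

HB.instance Definition _ := Measure.on blocks_measure.

Lemma blocks_measureE A : blocks_measure A =
  \sum_(n <oo) (weight R n)%:E * unit_prob (fiber n @^-1` A).
Proof. by []. Qed.

Lemma blocks_measureT : blocks_measure setT = 1.
Proof.
rewrite blocks_measureE -[RHS](weight_series R); apply: eq_eseriesr => n _.
by rewrite preimage_setT probability_setT mule1.
Qed.

HB.instance Definition _ :=
  Measure_isProbability.Build _ _ _ blocks_measure blocks_measureT.

Definition blocks_prob : probability X R := blocks_measure.

Lemma integral_truncn (f : nat -> \bar R) : (forall n, 0 <= f n) ->
  \int[blocks_prob]_x f (Num.truncn (x : R)) =
  \sum_(n <oo) (weight R n)%:E * f n.
Proof.
move=> f0; have mf := measurable_fun_truncn f.
rewrite ge0_integral_measure_series //; apply: eq_eseriesr => n _.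
rewrite ge0_integral_mscale // ge0_integral_distribution //.
congr (_ * _).
under eq_integral do rewrite /= truncn_fiber.
rewrite integral_cst // -[RHS]mule1; congr (_ * _).
exact: (probability_setT unit_prob).
Qed.

(** The map permutes the intervals as h does, so its effect on the measure is a
    permutation of a series with equal weights. *)
Lemma measure_preserving_fiberwise (h : nat -> nat) : bijective h ->
  (forall n, level (h n) = level n) -> measure_preserving blocks_prob (fiberwise h).
Proof.
move=> bh lh; split; first exact: measurable_fiberwise.
move=> A mA; rewrite /blocks_prob /= !blocks_measureE.
have W0 B n : 0 <= (weight R n)%:E * unit_prob (fiber n @^-1` B).
  by rewrite mule_ge0 // lee_fin weight_ge0.
rewrite [RHS]nneseries_esumT // [LHS]nneseries_esumT //.
rewrite [RHS](reindex_esum setT setT h) //; last first.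
  by have := bh; rewrite -setTT_bijective.
apply: eq_esum => n _; rewrite /weight lh; congr (_ * _).
congr (unit_prob _); apply/seteqP.
by split => u /=; rewrite fiberwise_fiber.
Qed.

Lemma unit_probE A : measurable A ->
  unit_prob A = lebesgue_measure (A `&` `[0%R, 1%R]%classic).
Proof.
move=> mA; rewrite /unit_prob /= /uniform_prob integral_uniform_pdf.
rewrite (eq_integral (fun=> 1)); last first.
  move=> x; rewrite inE /= in_itv /= => -[_ x01].
  by rewrite /uniform_pdf x01 subr0 invr1.
by rewrite integral_cst ?mul1e //; exact: measurableI.
Qed.

(** Every fiber meets the interval in a set of probability at most e, and the
    weights sum to 1. *)
Lemma blocks_prob_itv (a e : R) : (0 <= e)%R ->
  blocks_prob `[a, (a + e)%R]%classic <= e%:E.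
Proof.
move=> e0; have W0 n : 0 <= (weight R n)%:E by rewrite lee_fin weight_ge0.
rewrite /blocks_prob /= blocks_measureE -[leRHS]mule1 -(weight_series R).
rewrite -nneseriesZl //; apply: lee_nneseries => n _; first by rewrite mule_ge0.
rewrite [leRHS]muleC; apply: lee_wpmul2l => //.
have mU : measurable (fiber n @^-1` `[a, (a + e)%R]%classic).
  by rewrite -[X in measurable X]setTI; exact: measurable_fiber.
rewrite unit_probE //.
(* The point 1 is apart because fiber n sends it to n and not to n + 1. *)
apply: (@le_trans _ _
  (lebesgue_measure (`[(a - n%:R)%R, (a - n%:R + e)%R] `|` [set 1%R : X]))).
  apply: le_measure; rewrite ?inE.
  - exact: measurableI.
  - exact: measurableU.
  - move=> u [] /=; rewrite !in_itv /= /fiber => uae /andP[u0 u1].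
    have [->|un1] := eqVneq u 1%R; [by right|left].
    have f0 : Num.floor (u : R) = 0%R.
      by apply: floor_def; rewrite u0 /= lt_neqAle un1.
    by move: uae; rewrite f0 subr0; lra.
apply: le_trans (measureU2 lebesgue_measure _ _) _ => //.
rewrite -[leRHS]adde0; apply: leeD; last first.
  by rewrite /= (@lebesgue_measure_set1 R 1%R).
rewrite /= (@lebesgue_measure_itv R `[(a - n%:R)%R, (a - n%:R + e)%R]).
rewrite /= lte_fin; case: ifP => _; last by rewrite lee_fin.
by rewrite -EFinD lee_fin; lra.
Qed.

(** Cut the line into countably many cells of length e, with e less than the mass
    of A.  One of them meets A in a set of positive mass, and that mass is at
    most e. *)
Lemma blocks_prob_nonatomic : nonatomic blocks_prob.
Proof.
move=> A mA A0.
have [e e0 eA] : exists2 e : R, (0 < e)%R & e%:E < blocks_prob A.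
  have Af : blocks_prob A \is a fin_num by exact: fin_num_measure.
  exists (fine (blocks_prob A) / 2)%R.
    by rewrite divr_gt0 // fine_gt0 // A0 ltey_eq Af.
  rewrite -[ltRHS]fineK // lte_fin.
  have : (0 < fine (blocks_prob A))%R by rewrite fine_gt0 // A0 ltey_eq Af.
  by lra.
pose cell (i : int) : set X := [set x : X | Num.floor (x / e : R) = i].
have mcell i : measurable (cell i).
  have me : measurable_fun [set: X] (fun x : X => (x / e)%R : X).
    by apply: measurable_funM.
  have := me measurableT _ (measurable_floor_preimage [set i]).
  by rewrite setTI.
have cell_le i : blocks_prob (cell i) <= e%:E.
  apply: le_trans (blocks_prob_itv (i%:~R * e) (ltW e0)).
  apply: le_measure; rewrite ?inE //.
  move=> x /= xi; rewrite in_itv /=; have := floor_itv (x / e).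
  by rewrite xi ler_pdivlMr // ltr_pdivrMr // intrD mulrDl mul1r => /andP[-> /ltW].
have [[k Ak]|Anull] := pselect (exists k, 0 < blocks_prob (A `&` cell k)).
  exists (A `&` cell k); split => //.
  - exact: measurableI.
  - apply: le_lt_trans eA; apply: le_trans (cell_le k).
    by apply: le_measure; rewrite ?inE //; exact: measurableI.
exfalso; move: A0; rewrite lt_neqAle => /andP[/eqP + _]; apply; apply/esym.
have -> : A = \bigcup_n (A `&` if unpickle n is Some i then cell i else set0).
  apply/seteqP; split => [x Ax|x [n _ []//]].
  exists (pickle (Num.floor (x / e : R))) => [//|]; rewrite pickleK.
  by split; [exact: Ax|reflexivity].
have mF n : measurable (A `&` if unpickle n is Some i then cell i else set0).
  by apply: measurableI => //; case: unpickle.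
apply/negligibleP; first exact: bigcupT_measurable.
apply: negligible_bigcup => n; apply/negligibleP => //.
case: (unpickle n) => [i|]; last by rewrite setI0 measure0.
apply/eqP; rewrite eq_le measure_ge0 andbT leNgt; apply/negP => Ai.
by apply: Anull; exists i.
Qed.

Lemma line_standard_borel : @standard_borel R _ X.
Proof.
exists (R : completePseudoMetricType R), idfun; split.
- exact: norm_hausdorff.
- exists (range ratr); first by exact: sub_countable (card_image_le _ _) (countableP _).
  exact: dense_rat.
- by exists idfun.
move=> A; rewrite image_id; split=> [mA|].
  have : (@RGenOpens.G R).-sigma.-measurable A by rewrite -RGenOpens.measurableE.
  apply: smallest_sub; first exact: smallest_sigma_algebra.
  by move=> _ [x [y ->]]; apply: sub_sigma_algebra; exact: itv_open.
apply: smallest_sub; last by move=> U; exact: open_measurable.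
exact: sigma_algebra_measurable.
Qed.

End FiberedLine.

(** * Schreier distances *)
Section SchreierDistance.
Context (R : realType) (d : measure_display) (X : measurableType d).
Variables (mu : probability X R) (G : groupType) (S : seq G).
Variable a : pmp_action G mu.

Definition reach x k y :=
  exists2 w, word_in S w /\ foldl (fun z s => a s z) x w = y & (size w <= k)%N.

Lemma reach_refl x k : reach x k x.
Proof. by exists [::]. Qed.

Lemma reach_le x k k' y : (k <= k')%N -> reach x k y -> reach x k' y.
Proof. by move=> kk [w ? wk]; exists w => //; exact: leq_trans kk. Qed.

Lemma reach_trans y x k k' z : reach x k y -> reach y k' z ->
  reach x (k + k')%N z.
Proof.
move=> [u [Su <-] uk] [v [Sv <-] vk]; exists (u ++ v).
  by rewrite foldl_cat; split=> //; rewrite /word_in all_cat; exact/andP.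
by rewrite size_cat leq_add.
Qed.

Lemma foldl_act w : exists g, forall x, foldl (fun z s => a s z) x w = a g x.
Proof.
elim: w => [|s w [g gE]] /=; first by exists 1%g => x; rewrite act1.
by exists (g * s)%g => x; rewrite gE actM.
Qed.

Lemma reach_orbit x k y : reach x k y -> Defs.orbit a x y.
Proof. by move=> [w [_ <-] _]; have [g ->] := foldl_act w; exists g. Qed.

Lemma generates_reach : generates S ->
  forall g, exists k, forall x, reach x k (a g x).
Proof.
move=> Sgen g; have [w Sw <-] := Sgen g; exists (size w) => x.
(* The action of a product applies its last factor first. *)
exists (rev w); last by rewrite size_rev.
split; first by rewrite /word_in all_rev.
rewrite foldl_rev; elim: w {Sw} => [|s w IH] /=; first by rewrite act1.
by rewrite actM -IH.
Qed.

Lemma schreier_dist_ge0 x y : 0 <= schreier_dist S a x y.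
Proof. by apply: le_ereal_inf_tmp => _ [w _ <-]; rewrite lee_fin. Qed.

Lemma reach_schreier_dist x k y : reach x k y ->
  schreier_dist S a x y <= k%:R%:E.
Proof.
move=> [w wy wk]; apply: (@le_trans _ _ (size w)%:R%:E).
  by apply: ereal_inf_lbound; exists w.
by rewrite lee_fin ler_nat.
Qed.

Lemma le_schreier_dist x y e : (forall w, word_in S w ->
    foldl (fun z s => a s z) x w = y -> e <= (size w)%:R%:E) ->
  e <= schreier_dist S a x y.
Proof. by move=> H; apply: le_ereal_inf_tmp => _ [w [Sw wy] <-]; exact: H. Qed.

(** An infimum of natural numbers is attained or is that of the empty set. *)
Lemma schreier_distP x y : schreier_dist S a x y = +oo \/
  exists2 k, reach x k y & schreier_dist S a x y = k%:R%:E.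
Proof.
have [[k0 xy]|nxy] := pselect (exists k, reach x k y).
  have Q : exists k, `[< reach x k y >] by exists k0; apply/asboolP.
  right; case: (ex_minnP Q) => k /asboolP xky kmin; exists k => //.
  apply/eqP; rewrite eq_le reach_schreier_dist //=.
  apply: le_schreier_dist => w Sw wy; rewrite lee_fin ler_nat.
  by apply: kmin; apply/asboolP; exists w.
left; apply/eqP; rewrite -leye_eq; apply: le_schreier_dist => w Sw wy.
by exfalso; apply: nxy; exists (size w); exists w.
Qed.

Lemma schreier_dist_triangle y x z :
  schreier_dist S a x z <= schreier_dist S a x y + schreier_dist S a y z.
Proof.
have [->|[k xy ->]] := schreier_distP x y.
  by rewrite addye ?leey // gt_eqF // (lt_le_trans _ (schreier_dist_ge0 _ _)).
have [->|[l yz ->]] := schreier_distP y z; first by rewrite addey ?leey.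
by rewrite -EFinD -natrD; apply: reach_schreier_dist; exact: reach_trans yz.
Qed.

End SchreierDistance.

(** * Actions of F_2 by involutions of nat *)

(** The conditions under which a pair of involutions of nat, indexed by the
    generators of F_2, acts on the line by measure-preserving bijections. *)
Record block_involutions := BlockInvolutions {
  gen :> bool -> nat -> nat ;
  genK : forall l, involutive (gen l) ;
  gen0 : forall l, gen l 0%N = 0%N ;
  level_gen : forall l n, level (gen l n) = level n }.

Section FreeGroupOnBlocks.
Variable s : block_involutions.

(** The exponent of a letter is immaterial, the generators being involutions. *)
Definition word_act (ws : seq (bool * bool)) n :=
  foldr (fun c z => s c.1 z) n ws.

Lemma word_act_bij ws : bijective (word_act ws).
Proof.
elim: ws => [|c ws IH]; first by exists id.
exact: bij_comp (inv_bij (genK s c.1)) IH.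
Qed.

Lemma level_word_act ws n : level (word_act ws n) = level n.
Proof. by elim: ws => //= c ws IH; rewrite level_gen. Qed.

Lemma word_act0 ws : word_act ws 0%N = 0%N.
Proof. by elim: ws => //= c ws ->; exact: gen0. Qed.

Lemma word_act_push c ws n : word_act (push c ws) n = s c.1 (word_act ws n).
Proof.
case: ws => //= b ws; case: eqP => // ->.
by rewrite /= genK.
Qed.

Lemma word_act_wmul u v n :
  word_act (wmul u v) n = word_act u (word_act v n).
Proof. by elim: u => //= c u IH; rewrite word_act_push IH. Qed.

End FreeGroupOnBlocks.

Lemma gap_triangle m n p : (gap m p <= gap m n + gap n p)%N.
Proof. by rewrite /gap; lia. Qed.

Lemma gap_word_act (s : block_involutions) ws n :
  (forall l m, (gap (s l m) m <= 1)%N) ->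
  (gap (word_act s ws n) n <= size ws)%N.
Proof.
move=> s1; elim: ws => [|c ws IH] /=; first by rewrite /gap; lia.
apply: leq_trans (gap_triangle _ (word_act s ws n) _) _.
by rewrite -add1n leq_add.
Qed.

Definition path_involutions : block_involutions.
Proof.
exists path_gen; first exact: path_genK.
- by case.
- by case=> n; [exact: level_path_swap|exact: level_rung].
Defined.

Definition cycle_involutions : block_involutions.
Proof.
exists cycle_gen; first exact: cycle_genK.
- by case.
- by case=> n; [exact: level_cycle_swap|exact: level_rung].
Defined.

Lemma walk_cycle_gen l n :
  walk path_gen n (if l then gap (cycle_swap n) n else 1%N) (cycle_gen l n).
Proof.
case: l; first exact: walk_cycle_swap.
exact: (walk_step path_gen false).
Qed.

Lemma walk_path_gen l n : walk cycle_gen n 1 (path_gen l n).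
Proof.
case: l; last exact: (walk_step cycle_gen false).
have := walk_step cycle_gen true n; rewrite /= /cycle_swap /path_swap.
by case: ifP => _; case: ifP => // _ _; exact: walk_refl.
Qed.

Section LineAction.
Variables (R : realType) (s : block_involutions).
Let X := measurableTypeR R.
Let mu := blocks_prob R.

(** ** The action on the line *)
Definition line_act (g : F2) (x : X) : X := fiberwise (word_act s (word g)) x.

Lemma line_act1 x : line_act 1%g x = x.
Proof. exact: fiberwise_id. Qed.

Lemma line_actM g h x : line_act (g * h)%g x = line_act g (line_act h x).
Proof.
rewrite /line_act fiberwise_comp ?word_act0 //; apply: eq_fiberwise.
exact: word_act_wmul.
Qed.

Lemma line_act_mp g : measure_preserving mu (line_act g).
Proof.
apply: measure_preserving_fiberwise; first exact: word_act_bij.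
exact: level_word_act.
Qed.

Definition line_action : pmp_action F2 mu :=
  PmpAction line_act1 line_actM line_act_mp.

Definition letter (l : bool) : F2 := @FreeGroup bool [:: (l, false)] isT.

Section Reach.
Variables (S : seq F2) (C : nat).
Hypothesis reachC : forall l x, reach S line_action x C (fiberwise (s l) x).

(** An arbitrary generating set S only costs a factor C, the length in S of the
    two letters. *)
Lemma walk_reach h k x : walk s (Num.truncn (x : R)) k (h (Num.truncn (x : R))) ->
  reach S line_action x (C * k)%N (fiberwise h x).
Proof.
move=> [ls lsh lsk]; apply: (@reach_le _ _ _ _ _ _ _ _ (C * size ls)%N).
  by rewrite leq_mul2l lsk orbT.
rewrite -(@eq_fiberwise R (fun n => foldl (fun z l => s l z) n ls)) // {h k lsh lsk}.
elim: ls x => [|l ls IH] x; first by rewrite muln0 fiberwise_id; exact: reach_refl.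
rewrite mulnS /= -[X in fiberwise X x]/((fun n => foldl _ n ls) \o s l).
rewrite -fiberwise_comp ?gen0 //.
exact: reach_trans (reachC l x) (IH _).
Qed.

End Reach.

Lemma generates_reach_letters S : generates S ->
  exists C, forall l x, reach S line_action x C (fiberwise (s l) x).
Proof.
move=> Sgen; have [k0 H0] := generates_reach line_action Sgen (letter false).
have [k1 H1] := generates_reach line_action Sgen (letter true).
exists (maxn k0 k1) => -[] x.
  exact: reach_le (leq_maxr _ _) (H1 x).
exact: reach_le (leq_maxl _ _) (H0 x).
Qed.

Lemma walk_orbit h k x : walk s (Num.truncn (x : R)) k (h (Num.truncn (x : R))) ->
  Defs.orbit line_action x (fiberwise h x).
Proof.
move=> w; apply: (@reach_orbit _ _ _ _ _ [:: letter false; letter true] _ _ (1 * k)).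
apply: walk_reach w => l {}x; exists [:: letter l] => //; split => //.
by case: l; rewrite /word_in /= ?inE ?eqxx ?orbT.
Qed.

End LineAction.

(** * Integrals of Schreier distances *)
Section Integrals.
Variable R : realType.
Let X := measurableTypeR R.
Let mu := blocks_prob R.
Implicit Types (a : pmp_action F2 mu) (S : seq F2).

Lemma F2_words_countable : countable [set: seq F2].
Proof.
pose code (w : seq F2) : seq (seq (bool * bool)) := map (@word bool) w.
apply/countable_injP; exists (pickle \o code) => u v _ _ /=.
by move=> /(pcan_inj pickleK); apply: inj_map; exact: val_inj.
Qed.

(** The points at distance less than r from their image form a countable union,
    over the words w of length less than r, of the sets where w acts as T. *)
Lemma measurable_schreier_dist S a (T : X -> X) : measurable_fun setT T ->
  measurable_fun setT (fun x => schreier_dist S a x (T x)).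
Proof.
move=> mT; apply: (measurability _ (ErealGenInftyO.measurableE R)) => //.
move=> _ [_ [r ->] <-]; rewrite setTI.
rewrite (_ : _ @^-1` _ = \bigcup_(w : seq F2)
    [set x | (word_in S w && ((size w)%:R < r)%R) /\
             foldl (fun z g => a g z) x w = T x]); last first.
  apply/seteqP; split => x /=; rewrite in_itv /=.
    have [->//|[k [w [Sw wT] wk] ->]] := schreier_distP S a x (T x).
    rewrite lte_fin => kr; exists w => //; split => //; rewrite Sw /=.
    by apply: le_lt_trans kr; rewrite ler_nat.
  move=> [w _ /= [/andP[Sw wr] wT]].
  apply: (@le_lt_trans _ _ (size w)%:R%:E); last by rewrite lte_fin.
  by apply: reach_schreier_dist; exists w.
apply: countable_bigcupT_measurable; first exact: F2_words_countable.
move=> w; case: (_ && _); last first.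
  by rewrite (_ : [set _ | _] = set0) //; apply/seteqP; split => x // [].
have [g gE] := foldl_act a w; have [mg _] := act_mp a g.
have := measurable_fun_eqr mg mT => /(_ measurableT [set true]).
rewrite setTI => /(_ I); congr (measurable _); apply/seteqP; split => x /=.
  by move/eqP => <-; rewrite gE.
by move=> [_ <-]; rewrite gE eqxx.
Qed.

Lemma ge0_integral_mp (T : X -> X) (f : X -> \bar R) :
  measure_preserving mu T -> measurable_fun setT f -> (forall x, 0 <= f x) ->
  \int[mu]_x f (T x) = \int[mu]_x f x.
Proof.
move=> [mT muT] mf f0.
have := ge0_integral_pushforward mT mu measurableT mf (fun y _ => f0 y).
rewrite preimage_setT => <-; apply: eq_measure_integral => A mA _.
exact: muT.
Qed.

(** Distances are at most C times the lengths of walks, so the integral is at most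
    C times the weighted sum of F. *)
Lemma integral_schreier_dist_walk (s : block_involutions) S h (F : nat -> nat) D :
  generates S -> (forall n, walk s n (F n) (h n)) ->
  (forall j, (\sum_((4 ^ j).-1 <= n < (4 ^ j.+1).-1) F n <= D * 4 ^ j)%N) ->
  \int[mu]_x schreier_dist S (line_action R s) x (fiberwise h x) < +oo.
Proof.
move=> Sgen hF FD; have [C SC] := generates_reach_letters R s Sgen.
apply: (@le_lt_trans _ _
    (\int[mu]_x ((C * F (Num.truncn (x : R)))%N%:R)%:E)).
  apply: ge0_le_integral => //.
  - by move=> x _; exact: schreier_dist_ge0.
  - by apply: measurable_schreier_dist; exact: measurable_fiberwise.
  - exact: (measurable_fun_truncn (fun n => ((C * F n)%N%:R : R)%:E)).
  - by move=> x _; apply: reach_schreier_dist; exact: walk_reach.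
rewrite (@integral_truncn R (fun n => ((C * F n)%N%:R : R)%:E)); last first.
  by move=> n; rewrite lee_fin.
under eq_eseriesr do rewrite -EFinM.
apply: (@le_lt_trans _ _ ((C * D)%N%:R / 3)%:E); last by rewrite ltry.
apply: weighted_series_le => j; rewrite -big_distrr /= -mulnA.
by rewrite leq_mul2l FD orbT.
Qed.

(** By induction on the word of g: if g is c times k, the distance from x to g x
    is at most the distance from x to k x plus the distance from k x to c (k x),
    and x |-> k x preserves the measure, so the second term integrates like the
    cost of the letter c. *)
Lemma integral_schreier_dist_letters S a (t : block_involutions) :
  (forall l, \int[mu]_x schreier_dist S a x (fiberwise (t l) x) < +oo) ->
  forall g, \int[mu]_x schreier_dist S a x (line_action R t g x) < +oo.
Proof.
move=> H g; rewrite /= /line_act; elim: (word g) => [|c ws IH].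
  rewrite integral0_eq // => x _; apply/eqP; rewrite eq_le schreier_dist_ge0 andbT.
  by rewrite fiberwise_id; exact: (reach_schreier_dist (reach_refl _ _ _ 0)).
pose k := word_act t ws.
have mk : measure_preserving mu (fiberwise k).
  apply: measure_preserving_fiberwise; first exact: word_act_bij.
  exact: level_word_act.
have md h := measurable_schreier_dist S a (measurable_fiberwise h).
have d0 := schreier_dist_ge0 S a.
pose step y := schreier_dist S a y (fiberwise (t c.1) y).
have mstep : measurable_fun setT (step \o fiberwise k).
  apply: (measurableT_comp (md (t c.1))); exact: measurable_fiberwise.
apply: (@le_lt_trans _ _ (\int[mu]_x (schreier_dist S a x (fiberwise k x) +
    (step \o fiberwise k) x))).
  apply: ge0_le_integral => //; first exact: emeasurable_funD.
  move=> x _; rewrite -[word_act t _]/(t c.1 \o k).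
  rewrite -fiberwise_comp ?[k _]word_act0 //.
  exact: schreier_dist_triangle.
rewrite ge0_integralD //; last by move=> x _; exact: d0.
rewrite (ge0_integral_mp mk (md (t c.1))) //.
exact: lte_add_pinfty.
Qed.

Lemma integrable_schreier_dist S a T : measurable_fun setT T ->
  \int[mu]_x schreier_dist S a x (T x) < +oo ->
  mu.-integrable setT (fun x => schreier_dist S a x (T x)).
Proof.
move=> mT H; apply/integrableP; split; first exact: measurable_schreier_dist.
by under eq_integral do rewrite gee0_abs ?schreier_dist_ge0 //.
Qed.

(** An element of S is a word in the letters, so it moves points through at most
    D intervals, where D bounds the lengths of the words in S. *)
Lemma gap_le_schreier_dist (s : block_involutions) S :
  (forall l m, (gap (s l m) m <= 1)%N) ->
  exists2 D : R, (0 < D)%R & forall x y : X,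
    ((gap (Num.truncn (y : R)) (Num.truncn (x : R)))%:R / D)%:E <=
    schreier_dist S (line_action R s) x y.
Proof.
(* The successor keeps D positive; s and s^-1 have words of equal length. *)
move=> s1; pose D := (\max_(g <- S) size (word g)).+1.
exists D%:R => // x y; apply: le_schreier_dist => w Sw <-.
rewrite lee_fin ler_pdivrMr // -natrM ler_nat.
elim: w x Sw => [|g w IH] x /=; first by rewrite /gap; lia.
move=> /andP[gS /IH wg].
apply: leq_trans (gap_triangle _ (Num.truncn (line_act s g x : R)) _) _.
rewrite mulSn addnC leq_add //.
rewrite /line_act truncn_fiberwise ?word_act0 //.
apply: leq_trans (gap_word_act _ _ s1) _; rewrite /D.
case/orP: gS => [gS|gS].
  by rewrite ltnW // ltnS; exact: leq_bigmax_seq.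
have -> : size (word g) = size (word (g^-1)%g) by rewrite size_rev size_map.
by rewrite ltnW // ltnS; exact: leq_bigmax_seq.
Qed.

(** ** The path action and the cycle action *)
Definition path_action := line_action R path_involutions.
Definition cycle_action := line_action R cycle_involutions.

Lemma sub_orbit (s t : block_involutions) x :
  (forall l n, exists k, walk s n k (t l n)) ->
  Defs.orbit (line_action R t) x `<=` Defs.orbit (line_action R s) x.
Proof.
move=> st _ [g ->]; suff [k] : exists k,
    walk s (Num.truncn (x : R)) k (word_act t (word g) (Num.truncn (x : R))).
  exact: walk_orbit.
elim: (word g) => [|c ws [k wk]]; first by exists 0%N; exact: walk_refl.
have [k' wk'] := st c.1 (word_act t ws (Num.truncn (x : R))).
by exists (k + k')%N; exact: walk_trans wk wk'.
Qed.

Lemma same_orbit x : Defs.orbit cycle_action x = Defs.orbit path_action x.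
Proof.
apply/seteqP; split; apply: sub_orbit => l n.
  by eexists; exact: walk_cycle_gen.
by eexists; exact: walk_path_gen.
Qed.

Lemma cycle_generators_integrable S l : generates S ->
  \int[mu]_x schreier_dist S path_action x (fiberwise (cycle_gen l) x) < +oo.
Proof.
move=> Sgen.
apply: (@integral_schreier_dist_walk path_involutions _ _ _ 19 Sgen
  (walk_cycle_gen l)) => j.
case: l; first exact: sum_wrap_cost.
by rewrite sum_nat_const_nat muln1 expnS; lia.
Qed.

Lemma path_generators_integrable S l : generates S ->
  \int[mu]_x schreier_dist S cycle_action x (fiberwise (path_gen l) x) < +oo.
Proof.
move=> Sgen.
apply: (@integral_schreier_dist_walk cycle_involutions _ _ _ 3 Sgen
  (walk_path_gen l)) => j.
by rewrite sum_nat_const_nat muln1 expnS; lia.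
Qed.

Lemma fold_fiberwiseK : involutive (@fiberwise R fold_end).
Proof.
move=> x; rewrite fiberwise_comp // -[RHS]fiberwise_id; apply: eq_fiberwise.
exact: fold_endK.
Qed.

Definition fold_bij : mp_bij mu.
Proof.
exists (@fiberwise R fold_end); first exact: inv_bij fold_fiberwiseK.
apply: measure_preserving_fiberwise; first exact: inv_bij fold_endK.
exact: level_fold_end.
Defined.

Local Open Scope quotient_scope.

(** ** The automorphism that separates the full groups *)
Definition fold_aut : Aut mu := \pi fold_bij.

(** The map attached to a class is that of an unspecified representative. *)
Lemma fold_autE : {ae mu, forall x, fold_aut x = fiberwise fold_end x}.
Proof.
suff /asboolP : mp_ae_eq (repr fold_aut) fold_bij by [].
by apply/eqmodP; rewrite reprK.
Qed.

Lemma integral_fold_aut S a :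
  \int[mu]_x schreier_dist S a x (fold_aut x) =
  \int[mu]_x schreier_dist S a x (fiberwise fold_end x).
Proof.
apply: ae_eq_integral => //.
- apply: measurable_schreier_dist; exact: (mp_fun_mp (repr fold_aut)).1.
- by apply: measurable_schreier_dist; exact: measurable_fiberwise.
by apply: filterS fold_autE => x + _ => ->.
Qed.

Lemma fold_aut_cycle S : generates S -> L1_full_group S cycle_action fold_aut.
Proof.
move=> Sgen; split.
  apply: filterS fold_autE => x ->.
  exact: (@walk_orbit R cycle_involutions fold_end _ x (walk_fold_end _)).
rewrite integral_fold_aut.
exact: (@integral_schreier_dist_walk cycle_involutions _ _ _ 4 Sgen
  walk_fold_end sum_fold_cost).
Qed.

(** The gap is, up to the factor D, a lower bound for distances in the path, and
    its weighted sum along [fold_end] is infinite. *)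
Lemma fold_aut_path S : ~ L1_full_group S path_action fold_aut.
Proof.
move=> [_]; rewrite integral_fold_aut; apply/negP; rewrite -leNgt leye_eq.
have [D D0 HD] := @gap_le_schreier_dist path_involutions S gap_path_gen.
rewrite -leye_eq; pose f n : \bar R := ((gap (fold_end n) n)%:R / D)%:E.
have f0 n : 0 <= f n by rewrite lee_fin divr_ge0 // ltW.
apply: (@le_trans _ _ (\int[mu]_x f (Num.truncn (x : R)))); last first.
  apply: ge0_le_integral => //.
  - exact: measurable_fun_truncn.
  - by apply: measurable_schreier_dist; exact: measurable_fiberwise.
  - move=> x _; have := HD x (fiberwise fold_end x).
    by rewrite truncn_fiberwise.
rewrite integral_truncn // /f.
under eq_eseriesr do rewrite -EFinM mulrA mulrC EFinM.
rewrite nneseriesZl; last first.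
  by move=> n _; rewrite lee_fin mulr_ge0 // weight_ge0.
by rewrite (weighted_series_infty R sum_gap_fold_end) gt0_muley // lte_fin invr_gt0.
Qed.

End Integrals.

Theorem corollary5p3 (R : realType) :
  exists (d : measure_display) (X : measurableType d) (mu : probability X R)
         (a1 a2 : pmp_action F2 mu),
    standard_probability mu /\
    forall S1 S2 : seq F2, generates S1 -> generates S2 ->
      id_L1_orbit_equivalence S1 S2 a1 a2 /\
      L1_full_group S1 a1 <> L1_full_group S2 a2.
Proof.
exists _, (measurableTypeR R), (blocks_prob R), (cycle_action R), (path_action R).
split; first by split; [exact: line_standard_borel|exact: blocks_prob_nonatomic].
move=> S1 S2 gen1 gen2; split; last first.
  move=> E; apply: (@fold_aut_path R S2); rewrite -E; exact: fold_aut_cycle.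
split.
- by apply: aeW => x; exact: same_orbit.
- move=> h; apply: integrable_schreier_dist; first exact: (act_mp _ h).1.
  apply: integral_schreier_dist_letters => l.
  exact: path_generators_integrable.
- move=> g; apply: integrable_schreier_dist; first exact: (act_mp _ g).1.
  apply: integral_schreier_dist_letters => l.
  exact: cycle_generators_integrable.
Qed.
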